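(* Let $A$ be a unital finite-dimensional alternative algebra over some field $k$. Fix $x\in A$ and let $A_0$ be the $k$-subalgebra generated by $x$ (and $1$). Then the following properties are equivalent: (i) $x$ is left invertible, i.e. $\exists y\in A: yx=1$; (ii) $x$ is right invertible, i.e. $\exists y\in A: xy=1$; (iii) $x$ is left invertible in $A_0$, i.e. $\exists y\in A_0: yx=1$; (iv) $x$ is right invertible in $A_0$, i.e. $\exists y\in A_0: xy=1$; (v) $x$ is not a left zero divisor, i.e. $xy\neq0$ for all $y\in A\setminus\{0\}$; (vi) $x$ is not a right zero divisor, i.e. $yx\ne0$ for all $y\in A\setminus\{0\}$; (vii) $x$ is not a left zero divisor in $A_0$, i.e. $xy\ne0$ for all $y\in A_0\setminus\{0\}$; (viii) $x$ is not a right zero divisor in $A_0$, i.e. $yx\neq0$ for all $y\in A_0\setminus\{0\}$; (ix) $\det(L_x)\neq0$, where $L_x:A\to A$ is the $k$-linear map $w\mapsto xw$; (x) $\det(R_x)\ne0$, where $R_x:A\to A$ is the $k$-linear map $w\mapsto wx$. If $k=\mathbb{C}$, these properties are also equivalent to the following two assertions: (xi) $x$ is in the image of $\exp$, i.e. $\exists z\in A:\exp(z)=x$; (xii) $x$ is in the image of $\exp$ restricted to $A_0$, i.e. $\exists z\in A_0:\exp(z)=x$.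
   Context: An algebra $A$ (not necessarily associative) is alternative if $x(xy)=(xx)y$ and $x(yy)=(xy)y$ for all $x,y\in A$. For a finite-dimensional alternative complex algebra, $\exp(z)=\sum_{k=0}^{\infty}\frac{z^k}{k!}$ (powers are unambiguous in an alternative algebra; the series converges). *)

(* Defs.v *)
From HB Require Import structures.
From mathcomp Require Import all_boot all_order all_algebra.
From mathcomp Require Import complex.
From mathcomp Require Import all_classical all_reals all_analysis.

Set Implicit Arguments.
Unset Strict Implicit.
Unset Printing Implicit Defensive.

Import Order.TTheory GRing.Theory Num.Theory.
Import numFieldNormedType.Exports.

Local Open Scope classical_set_scope.
Local Open Scope ring_scope.

(* The product is not assumed associative, so the ring structures of MathComp
   do not apply. The zero algebra, in which 1 = 0, is allowed. *)
HB.mixin Record Vector_isAltAlgebra (k : fieldType) A of Vector k A := {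
  aone : A;
  amul : A -> A -> A;
  amul_linear_l : forall y, linear (amul^~ y);
  amul_linear_r : forall x, linear (amul x);
  amul1l : left_id aone amul;
  amul1r : right_id aone amul;
  amul_altl : forall x y, amul x (amul x y) = amul (amul x x) y;
  amul_altr : forall x y, amul x (amul y y) = amul (amul x y) y
}.

#[short(type="altAlgType")]
HB.structure Definition AltAlgebra (k : fieldType) :=
  { A of Vector k A & Vector_isAltAlgebra k A }.

Declare Scope alt_scope.
Delimit Scope alt_scope with alt.
Notation "x ** y" := (amul x y) (at level 40, left associativity) : alt_scope.
Notation "\one" := aone (at level 0) : alt_scope.
Local Open Scope alt_scope.

Section AltAlgebraTheory.
Context {k : fieldType} {A : altAlgType k}.
Implicit Types (x y z : A) (U : {vspace A}).

Definition lmult x : 'End(A) := linfun (amul x).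
Definition rmult x : 'End(A) := linfun (amul^~ x).

Lemma lmultE x w : lmult x w = x ** w.
Proof.
pose f := GRing.isSemilinear.Build k A A _ (amul x)
  (GRing.semilinear_linear (amul_linear_r x)).
pose F : {linear A -> A} := HB.pack (amul x) f.
exact: (lfunE F w).
Qed.

Lemma rmultE x w : rmult x w = w ** x.
Proof.
pose f := GRing.isSemilinear.Build k A A _ (amul^~ x)
  (GRing.semilinear_linear (amul_linear_l x)).
pose F : {linear A -> A} := HB.pack (amul^~ x) f.
exact: (lfunE F w).
Qed.

Definition end_det (f : 'End(A)) : k :=
  \det (passmx.mxof (vbasis {:A}) (vbasis {:A}) f).

Definition unital_subalg U : Prop :=
  \one \in U /\ {in U &, forall y z, y ** z \in U}.

Definition subalg_gen x : set A :=
  [set y | forall U, unital_subalg U -> x \in U -> y \in U].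

Definition apow z n : A := iter n (amul z) \one.

End AltAlgebraTheory.

Section Exponential.
Context {K : numFieldType} {A : altAlgType K}.

Definition exp_psum (z : A) (n : nat) : A :=
  \sum_(0 <= j < n) (j`!%:R)^-1 *: apow z j.

(* The limit is taken in the (unique) vector space topology of the finite
   dimensional space A, i.e. in coordinates. For K = R[i] the series always
   converges, so the default value of lim is never used. *)
Definition altexp (z : A) : A :=
  passmx.vecof (vbasis {:A})
    (lim (passmx.rVof (vbasis {:A}) (exp_psum z n) @[n --> \oo])).

End Exponential.

(* Main.v *)
Require Import Defs.
From HB Require Import structures.
From mathcomp Require Import all_boot all_order all_algebra.
From mathcomp Require Import complex.
From mathcomp Require Import all_classical all_reals all_analysis.
From mathcomp Require Import ring.

(** In an alternative algebra the associator is alternating, and the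
Teichmüller identity propagates (x, w, _) = 0 to (x, x w, _) = 0; hence every
polynomial in x associates with x and any third element ([assoc_aeval]).
Consequently p |-> p(x) is multiplicative, and its image, which lies in every
unital subalgebra containing x, is a quotient of k[X] by a monic polynomial p,
the annihilator of x. Everything is decided by p(0). If p(0) <> 0, then writing
p = X q + p(0) gives a two-sided inverse -q(x)/p(0) of x. If p = X q, then
q(x) <> 0 is annihilated by x on both sides. Since the associator of x, q(x)
and any y in A vanishes in every order, such a polynomial inverse makes both
multiplications by x injective on all of A, while such a zero divisor rules
out one-sided inverses anywhere in A ([invertible_tfae]).

Over the complex numbers, the partial sums of exp(r(x)) are the values at x of
E_n(r), where E_n is the truncated exponential polynomial. They converge
coordinatewise, and since the polynomials in x form a subspace, the limit is
s(x) for some polynomial s. Ideals containing p are closed under such limits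
([cvg_coord_dvdp]), so congruences satisfied by all the E_n(r) pass to s. In
particular s(a) = exp(r(a)) at each root a of p ([is_pexp_root]). With r = X,
s has no root in common with p, so exp(x) = s(x) is invertible by Bézout.

Conversely, if p(0) <> 0, a logarithm r of X modulo p is built by adding the
linear factors of p one at a time ([polynomial_log]). Let exp(r) = X modulo q
and let X - a be the next factor. One corrects r by a multiple c q, which
does not disturb the congruence modulo q. If q(a) <> 0, c is chosen so that
exp(r(a) + c q(a)) = a, by surjectivity of the scalar exponential onto nonzero
numbers. If q(a) = 0, then q^2 vanishes modulo (X - a) q and exp(r + c q) is
exp(r) (1 + c q) there, so that the condition on c is a linear equation with
leading coefficient a <> 0. *)

Set Implicit Arguments.
Unset Strict Implicit.
Unset Printing Implicit Defensive.

Import Order.TTheory GRing.Theory Num.Theory.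
Import numFieldNormedType.Exports.

Local Open Scope classical_set_scope.
Local Open Scope ring_scope.
Local Open Scope alt_scope.

(** * The associator of an alternative algebra *)

Section Associator.
Context {k : fieldType} {A : altAlgType k}.
Implicit Types (w x y z : A) (c : k).

Lemma amulDl x y z : (x + y) ** z = x ** z + y ** z.
Proof. by rewrite -!rmultE linearD. Qed.

Lemma amulDr x y z : x ** (y + z) = x ** y + x ** z.
Proof. by rewrite -!lmultE linearD. Qed.

Lemma amulBl x y z : (x - y) ** z = x ** z - y ** z.
Proof. by rewrite -!rmultE linearB. Qed.

Lemma amulBr x y z : x ** (y - z) = x ** y - x ** z.
Proof. by rewrite -!lmultE linearB. Qed.

Lemma amulZl c x y : (c *: x) ** y = c *: (x ** y).
Proof. by rewrite -!rmultE linearZ. Qed.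

Lemma amulZr c x y : x ** (c *: y) = c *: (x ** y).
Proof. by rewrite -!lmultE linearZ. Qed.

Lemma amul0x x : 0 ** x = 0.
Proof. by rewrite -rmultE linear0. Qed.

Lemma amulx0 x : x ** 0 = 0.
Proof. by rewrite -lmultE linear0. Qed.

Definition assoc x y z : A := x ** y ** z - x ** (y ** z).

Lemma assocE0 x y z : assoc x y z = 0 -> x ** y ** z = x ** (y ** z).
Proof. by move/eqP; rewrite subr_eq0 => /eqP. Qed.

Lemma assocDl x x' y z : assoc (x + x') y z = assoc x y z + assoc x' y z.
Proof. by rewrite /assoc !amulDl opprD addrACA. Qed.

Lemma assocDm x y y' z : assoc x (y + y') z = assoc x y z + assoc x y' z.
Proof. by rewrite /assoc !(amulDl, amulDr) opprD addrACA. Qed.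

Lemma assocDr x y z z' : assoc x y (z + z') = assoc x y z + assoc x y z'.
Proof. by rewrite /assoc !amulDr opprD addrACA. Qed.

Lemma assocZm c x y z : assoc x (c *: y) z = c *: assoc x y z.
Proof. by rewrite /assoc !(amulZr, amulZl) scalerBr. Qed.

Lemma assoc_diagl x z : assoc x x z = 0.
Proof. by rewrite /assoc amul_altl subrr. Qed.

Lemma assoc_diagr x z : assoc x z z = 0.
Proof. by rewrite /assoc amul_altr subrr. Qed.

(** Alternativity says that the associator vanishes when two adjacent arguments
coincide; polarising makes it alternating in every characteristic. *)
Lemma assoc_swapl x y z : assoc y x z = - assoc x y z.
Proof.
apply/eqP; rewrite -addr_eq0 addrC.
have := assoc_diagl (x + y) z.
by rewrite assocDl !assocDm !assoc_diagl addr0 add0r => ->.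
Qed.

Lemma assoc_swapr x y z : assoc x z y = - assoc x y z.
Proof.
apply/eqP; rewrite -addr_eq0 addrC.
have := assoc_diagr x (y + z).
by rewrite assocDm !assocDr !assoc_diagr addr0 add0r => ->.
Qed.

Lemma assoc_rot x y z : assoc y z x = assoc x y z.
Proof. by rewrite assoc_swapr assoc_swapl opprK. Qed.

(** An identity valid in any nonassociative algebra: after expansion the terms
cancel in pairs. *)
Lemma teichmuller w x y z :
  assoc (w ** x) y z - assoc w (x ** y) z + assoc w x (y ** z)
  = w ** assoc x y z + assoc w x y ** z.
Proof.
rewrite /assoc !(amulBl, amulBr).
set a := _ ** _ ** _ ** _; set b := w ** x ** (_ ** _).
set c := w ** (_ ** _) ** _; set d := w ** (_ ** _ ** _).
set e := w ** (_ ** (_ ** _)).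
rewrite opprB addrAC [a - b + _]addrA subrK.
by rewrite [LHS]addrACA [a + d]addrC addrACA.
Qed.

(** The inductive step behind power-associativity. One application of the
Teichmüller identity reduces (x, x w, y) to (x x, w, y), and another one, with
the arguments in the order w, y, x, x, shows that the latter vanishes. *)
Lemma assoc_amul x w :
  (forall y, assoc x w y = 0) -> forall y, assoc x (x ** w) y = 0.
Proof.
move=> xw0 y.
have wxx : assoc w y (x ** x) = 0.
  have := teichmuller w y x x.
  rewrite !assoc_diagr amulx0 sub0r !add0r [assoc w y x]assoc_rot.
  rewrite [assoc w (y ** x) x]assoc_rot !xw0 amul0x oppr0 add0r.
  by [].
have := teichmuller x x w y.
rewrite !assoc_diagl xw0 amulx0 amul0x !addr0 -assoc_rot wxx sub0r.
by move/eqP; rewrite oppr_eq0 => /eqP.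
Qed.

End Associator.

(** * Polynomials in one element *)

Section PolynomialEvaluation.
Context {k : fieldType} {A : altAlgType k}.
Implicit Types (w x y z : A) (c : k) (p q : {poly k}).

Definition aeval x p : A := \sum_(i < size p) p`_i *: apow x i.

Lemma aeval_widen n x p : (size p <= n)%N ->
  aeval x p = \sum_(i < n) p`_i *: apow x i.
Proof.
move=> pn; rewrite /aeval (big_ord_widen n (fun i => p`_i *: apow x i) pn).
rewrite big_mkcond; apply: eq_bigr => i _.
by case: ltnP => // /(nth_default 0) ->; rewrite scale0r.
Qed.

Lemma aeval_linear x : linear (aeval x).
Proof.
move=> c p q; pose n := maxn (size p) (size q).
have pn : (size p <= n)%N by rewrite leq_maxl.
have qn : (size q <= n)%N by rewrite leq_maxr.
have pqn : (size (c *: p + q : {poly k})%R <= n)%N.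
  rewrite (leq_trans (size_polyD _ _)) // geq_max qn andbT.
  by rewrite (leq_trans (size_scale_leq _ _)).
rewrite !(@aeval_widen n) // scaler_sumr -big_split.
by apply: eq_bigr => i _; rewrite coefD coefZ scalerDl scalerA.
Qed.

HB.instance Definition _ x := GRing.isSemilinear.Build k {poly k} A _
  (aeval x) (GRing.semilinear_linear (aeval_linear x)).

Lemma aevalC x c : aeval x c%:P = c *: \one.
Proof. by rewrite (@aeval_widen 1) ?size_polyC_leq1 // big_ord1 coefC. Qed.

Lemma aeval1 x : aeval x 1 = \one.
Proof. by rewrite -[1]/(1%:P) aevalC scale1r. Qed.

Lemma aevalXM x p : aeval x (p * 'X) = x ** aeval x p.
Proof.
rewrite (@aeval_widen (size p).+1) ?size_polyMX_leq //; last first.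
  by rewrite (leq_trans (size_polyMleq _ _)) // size_polyX addn2.
rewrite big_ord_recl coefMX /= scale0r add0r -lmultE /aeval linear_sum /=.
by apply: eq_bigr => i _; rewrite coefMX /= linearZ /= lmultE.
Qed.

Lemma aevalX x : aeval x 'X = x.
Proof. by rewrite -['X]mul1r aevalXM aeval1 amul1r. Qed.

(** The special case of Artin's theorem that the whole argument rests on. *)
Lemma assoc_aeval x p y : assoc x (aeval x p) y = 0.
Proof.
elim/poly_ind: p y => [|p c IH] y.
  by rewrite linear0 /assoc amulx0 !amul0x amulx0 subrr.
rewrite linearD /= aevalXM aevalC assocDm assocZm assoc_amul // add0r.
by rewrite /assoc amul1r amul1l subrr scaler0.
Qed.

Lemma aevalM x p q : aeval x (p * q) = aeval x p ** aeval x q.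
Proof.
elim/poly_ind: p => [|p c IH]; first by rewrite mul0r !linear0 amul0x.
rewrite mulrDl !linearD /= mulrAC !aevalXM IH amulDl.
rewrite -(assocE0 (assoc_aeval x p _)); congr (_ + _).
by rewrite mul_polyC linearZ /= aevalC amulZl amul1l.
Qed.

Lemma aevalMX x p : aeval x (p * 'X) = aeval x p ** x.
Proof. by rewrite aevalM aevalX. Qed.

Lemma apow_aeval x p n : apow (aeval x p) n = aeval x (p ^+ n).
Proof.
by elim: n => [|n IH]; rewrite ?expr0 ?aeval1 // exprS aevalM -IH.
Qed.

Lemma aeval_subalg_gen x p : subalg_gen x (aeval x p).
Proof.
move=> U [U1 UM] Ux; elim/poly_ind: p => [|p c IH].
  by rewrite linear0 mem0v.
by rewrite linearD /= aevalXM aevalC rpredD ?rpredZ // UM.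
Qed.

Lemma aevalXn x n : aeval x 'X^n = apow x n.
Proof. by rewrite -apow_aeval aevalX. Qed.

Definition powers x d := [tuple apow x (i : 'I_d) | i < d].

Lemma aeval_rVpoly x d (v : 'rV[k]_d) :
  aeval x (rVpoly v) = \sum_(i < d) v 0 i *: (powers x d)`_i.
Proof.
rewrite (@aeval_widen d) ?size_poly //; apply: eq_bigr => i _.
by rewrite coef_rVpoly_ord nth_mktuple.
Qed.

(** A family of more than dim A powers of x is linearly dependent. *)
Lemma annihilator_neq0 x : exists2 p, p != 0 & aeval x p = 0.
Proof.
pose d := (\dim {:A}).+1.
have dep : ~ free (powers x d).
  rewrite /free size_tuple => /eqP dimX.
  by have := dimvS (subvf <<powers x d>>); rewrite dimX ltnn.
have [v v0 xv0] : exists2 v : 'rV[k]_d, v <> 0 & aeval x (rVpoly v) = 0.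
  apply: contrapT => nex; apply: dep; apply/freeP => c c0 i.
  apply: contrapT => ci; apply: nex; exists (\row_j c j).
    by move/rowP/(_ i); rewrite !mxE.
  by rewrite aeval_rVpoly -[RHS]c0; apply: eq_bigr => j _; rewrite mxE.
exists (rVpoly v) => //; apply/eqP => v0'; apply: v0.
by rewrite -[v]rVpolyK v0' linear0.
Qed.

(** Euclidean division by a nonzero annihilating polynomial of least degree.
When A is the zero algebra, p = 1. *)
Lemma annihilatorP x :
  exists2 p, p \is monic & forall q, aeval x q = 0 <-> p %| q.
Proof.
pose P n := `[< exists p, [/\ p != 0, aeval x p = 0 & size p = n] >].
have exP : exists n, P n.
  have [p p0 xp] := annihilator_neq0 x.
  by exists (size p); apply/asboolP; exists p.
case: (ex_minnP exP) => m /asboolP[p [p0 xp szp]] minm.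
exists ((lead_coef p)^-1 *: p).
  by rewrite monicE lead_coefZ mulVf ?lead_coef_eq0.
move=> q; rewrite dvdpZl ?invr_eq0 ?lead_coef_eq0 //; split=> [xq|]; last first.
  by move/dvdpP=> [r ->]; rewrite aevalM xp amulx0.
apply: contrapT => /negP; rewrite /dvdp => r0.
have xr : aeval x (q %% p) = 0.
  by move: xq; rewrite {1}(divp_eq q p) linearD /= aevalM xp amulx0 add0r.
have := minm (size (q %% p)).
rewrite -szp leqNgt ltn_modp p0 => /(_ _)/notF; apply.
by apply/asboolP; exists (q %% p); split=> //; rewrite -size_poly_eq0.
Qed.

(** Minimality of the annihilator p = q X forbids q(x) = 0. *)
Lemma annihilator_root0 x p : p \is monic ->
  (forall q, aeval x q = 0 <-> p %| q) -> root p 0 ->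
  exists q, [/\ aeval x q != 0, aeval x q ** x = 0 & x ** aeval x q = 0].
Proof.
move=> pm pP /factor_theorem[q]; rewrite subr0 => pE.
have xp : aeval x p = 0 by apply/pP.
exists q; rewrite -aevalMX -aevalXM -pE; split=> //.
have q0 : q != 0.
  apply: contraTneq pm => q0.
  by rewrite pE q0 mul0r monicE lead_coef0 eq_sym oner_eq0.
apply/eqP => /pP; rewrite pE => /dvdp_leq.
by rewrite q0 size_mulX // ltnn => /(_ isT).
Qed.

(** Over k[x] = k[X]/(p), x is invertible or a zero divisor according to whether
p(0) is nonzero; in both cases the witness is a polynomial in x. *)
Lemma inverse_or_zero_divisor x :
  (exists2 q, aeval x q ** x = \one & x ** aeval x q = \one) \/
  (exists q, [/\ aeval x q != 0, aeval x q ** x = 0 & x ** aeval x q = 0]).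
Proof.
have [p pm pP] := annihilatorP x.
have [p0|p0] := boolP (root p 0); first by right; exact: annihilator_root0 p0.
left; have /factor_theorem : root (p - (p.[0])%:P) 0.
  by rewrite rootE !hornerE subrr.
rewrite subr0 => -[q /(canRL (subrK _)) pE].
have xq : aeval x (q * 'X) = - p.[0] *: \one.
  have : aeval x p = 0 by apply/pP.
  rewrite {1}pE linearD /= aevalC scaleNr => /eqP.
  by rewrite addr_eq0 => /eqP.
exists (- p.[0]^-1 *: q); rewrite -?aevalMX -?aevalXM -scalerAl linearZ /= xq;
by rewrite scalerA mulrNN mulVf ?scale1r.
Qed.

End PolynomialEvaluation.

(** * Invertible elements and zero divisors *)

Section Invertibility.
Context {k : fieldType} {A : altAlgType k}.
Implicit Types (x y : A).

Lemma end_det_neq0 (f : 'End(A)) : (end_det f != 0) = (lker f == 0%VS).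
Proof.
have eb := vbasisP {:A}.
rewrite -unitfE -[_ \is a _]/(_ \in unitmx); apply/idP/idP => [fU|/lker0_compfV ff].
  rewrite -subv0; apply/subvP => v; rewrite memv_ker memv0 => /eqP fv.
  rewrite -(passmx.rVof_eq0 eb) -(mulmxK fU (passmx.rVof _ _)).
  rewrite -passmx.rVof_app // fv (_ : passmx.rVof _ 0 = 0) ?mul0mx //.
  by apply/eqP; rewrite passmx.rVof_eq0.
have : passmx.mxof (vbasis {:A}) (vbasis {:A}) (f \o f^-1)%VF = 1%:M.
  by rewrite ff passmx.mxof1 // (basis_free eb).
by rewrite (passmx.mxof_comp _ _ eb) // => /mulmx1_unit[].
Qed.

Lemma lker0P (f : 'End(A)) :
  reflect (forall y : A, y != 0 -> f y != 0) (lker f == 0%VS).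
Proof.
apply: (iffP idP) => [f0 y|f0].
  by apply: contra => /eqP fy; rewrite -memv0 -(eqP f0) memv_ker fy.
rewrite -subv0; apply/subvP => v; rewrite memv_ker memv0.
by apply: contraLR; exact: f0.
Qed.

(** By [inverse_or_zero_divisor] all ten conditions hold or all ten fail. The
polynomial witness associates with x and an arbitrary element of A, which is
how it controls one-sided inverses and zero divisors lying outside A0. *)
Lemma invertible_tfae x :
  let A0 := subalg_gen x in
     [<-> (exists y : A, y ** x = \one);
          (exists y : A, x ** y = \one);
          (exists2 y : A, A0 y & y ** x = \one);
          (exists2 y : A, A0 y & x ** y = \one);
          (forall y : A, y != 0 -> x ** y != 0);
          (forall y : A, y != 0 -> y ** x != 0);
          (forall y : A, A0 y -> y != 0 -> x ** y != 0);
          (forall y : A, A0 y -> y != 0 -> y ** x != 0);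
          end_det (lmult x) != 0;
          end_det (rmult x) != 0].
Proof.
move=> A0.
have assoc3 q y : assoc y x (aeval x q) = 0 by rewrite -assoc_rot assoc_aeval.
have assoc1 q y : assoc (aeval x q) x y = 0.
  by rewrite assoc_swapl assoc_aeval oppr0.
have [[q qx xq]|[q [q0 qx xq]]] := inverse_or_zero_divisor x; last first.
  have A0q : A0 (aeval x q) by exact: aeval_subalg_gen.
  have left_inv y : y ** x = \one -> False.
    move=> yx; case/eqP: q0; rewrite -[LHS]amul1l -yx.
    by rewrite (assocE0 (assoc3 q y)) xq amulx0.
  have right_inv y : x ** y = \one -> False.
    move=> xy; case/eqP: q0; rewrite -[LHS]amul1r -xy.
    by rewrite -(assocE0 (assoc1 q y)) qx amul0x.
  have ldiv : ~ x ** aeval x q != 0 by rewrite xq eqxx.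
  have rdiv : ~ aeval x q ** x != 0 by rewrite qx eqxx.
  tfae.
  - by case=> y /left_inv.
  - by case=> y /right_inv.
  - by case=> y _ /left_inv.
  - by case=> y _ /right_inv.
  - by move/(_ _ q0).
  - by move/(_ _ q0).
  - by move/(_ _ A0q q0).
  - by move/(_ _ A0q q0).
  - by rewrite end_det_neq0 => /lker0P/(_ _ q0); rewrite lmultE.
  - by rewrite end_det_neq0 => /lker0P/(_ _ q0); rewrite rmultE.
have A0q : A0 (aeval x q) by exact: aeval_subalg_gen.
have lreg (y : A) : y != 0 -> x ** y != 0.
  apply: contraNneq => xy; rewrite -[y]amul1l -qx.
  by rewrite (assocE0 (assoc1 q y)) xy amulx0.
have rreg (y : A) : y != 0 -> y ** x != 0.
  apply: contraNneq => yx; rewrite -[y]amul1r -xq.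
  by rewrite -(assocE0 (assoc3 q y)) yx amul0x.
have ldet : end_det (lmult x) != 0.
  by rewrite end_det_neq0; apply/lker0P => y; rewrite lmultE; exact: lreg.
have rdet : end_det (rmult x) != 0.
  by rewrite end_det_neq0; apply/lker0P => y; rewrite rmultE; exact: rreg.
tfae=> // _.
- by exists (aeval x q).
- by exists (aeval x q).
- by exists (aeval x q).
- by move=> y _; exact: lreg.
- by move=> y _; exact: rreg.
- by exists (aeval x q).
Qed.

End Invertibility.

(** * The complex exponential function *)

Section ExpPoly.
Context {K : numFieldType}.
Implicit Types (a b : K).

Definition exp_poly (n : nat) : {poly K} := \poly_(i < n) (i`!%:R)^-1.

Lemma horner_exp_poly n a :
  (exp_poly n).[a] = \sum_(i < n) (i`!%:R)^-1 * a ^+ i.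
Proof. by rewrite horner_poly. Qed.

(* The truncated series of exp(a X) as a polynomial in X, so that the Cauchy
product of two series is the coefficient formula for a product. *)
Let scaled n a : {poly K} := \poly_(i < n) ((i`!%:R)^-1 * a ^+ i).

(** The coefficients of degree less than n of exp(a X) exp(b X) are those of
exp((a + b) X), so only the higher ones remain in the difference. *)
Lemma exp_poly_add n a b :
  (exp_poly n).[a] * (exp_poly n).[b] - (exp_poly n).[a + b]
  = \sum_(i < n) (scaled n a * scaled n b)`_(n + i).
Proof.
have scaled1 c : (scaled n c).[1] = (exp_poly n).[c].
  rewrite horner_poly horner_exp_poly; apply: eq_bigr => i _.
  by rewrite expr1n mulr1.
have szAB : (size (scaled n a * scaled n b)%R <= n + n)%N.
  apply: leq_trans (size_polyMleq _ _) _.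
  by apply: leq_trans (leq_pred _) _; rewrite leq_add ?size_poly.
rewrite -!scaled1 -hornerM (horner_coef_wide _ szAB) big_split_ord /=.
have -> : (scaled n (a + b)).[1] =
    \sum_(i < n) (scaled n a * scaled n b)`_i * 1 ^+ i.
  rewrite horner_poly; apply: eq_bigr => -[m mn] _ /=; congr (_ * _).
  rewrite mulrC coefMr exprDn mulr_suml; apply: eq_bigr => -[j jm] _ /=.
  rewrite !coef_poly (leq_ltn_trans _ mn) ?leq_subr //.
  rewrite (leq_ltn_trans _ mn); last by rewrite -ltnS.
  have jm' : (j <= m)%N by rewrite -ltnS.
  have f0 l : l`!%:R != 0 :> K by rewrite pnatr_eq0 -lt0n fact_gt0.
  rewrite -mulr_natr -(bin_fact jm') !natrM.
  field.
  by rewrite !f0 pnatr_eq0 -lt0n bin_gt0.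
by rewrite addrAC subrr add0r; apply: eq_bigr => i _; rewrite expr1n mulr1.
Qed.

(** The remaining coefficients are positive combinations of monomials in a and
b. This reduces the functional equation of the exponential to nonnegative reals. *)
Lemma exp_poly_add_le n a b :
  `|(exp_poly n).[a] * (exp_poly n).[b] - (exp_poly n).[a + b]| <=
  (exp_poly n).[`|a|] * (exp_poly n).[`|b|] - (exp_poly n).[`|a| + `|b|].
Proof.
rewrite !exp_poly_add; apply: le_trans (ler_norm_sum _ _ _) _.
apply: ler_sum => i _; rewrite !coefM.
apply: le_trans (ler_norm_sum _ _ _) _; apply: ler_sum => j _.
rewrite normrM !coef_poly; apply: ler_pM => //; case: ifP => _; rewrite ?normr0 //.
  by rewrite normrM normfV normr_nat normrX.
by rewrite normrM normfV normr_nat normrX.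
Qed.

Definition is_cexp a b := (exp_poly n).[a] @[n --> \oo] --> b.

Lemma is_cexp_unique a b c : is_cexp a b -> is_cexp a c -> b = c.
Proof. by move=> ab ac; apply: cvg_unique ab ac; exact: norm_hausdorff. Qed.

End ExpPoly.

Section ComplexExp.
Local Open Scope complex_scope.
Local Notation Re := (@complex.Re _).
Local Notation Im := (@complex.Im _).
Context {R : realType}.
Local Notation C := (Num.NumField.sort (R[i] : numFieldType)).
Implicit Types (a b : C) (u : nat -> C).

Lemma cvg_complex u (l : C) :
  Re (u n) @[n --> \oo] --> Re l -> Im (u n) @[n --> \oo] --> Im l ->
  u n @[n --> \oo] --> l.
Proof.
move=> uRe uIm; apply/cvgrPdist_lt => e e0.
have [eRe eIm] : 0 < Re e /\ e = (Re e)%:C.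
  by case: e e0 => x y; rewrite ltcE /= => /andP[/eqP -> ->].
have e2 : 0 < Re e / 2 by rewrite divr_gt0.
move/cvgrPdist_lt: uRe => /(_ _ e2) uRe.
move/cvgrPdist_lt: uIm => /(_ _ e2) uIm.
near=> n.
have -> : l - u n = (Re l - Re (u n))%:C + 'i%C * (Im l - Im (u n))%:C.
  rewrite {1}[l]complexE {1}[u n]complexE !rmorphB /=; ring.
apply: le_lt_trans (ler_normD _ _) _.
rewrite normrM !normc_def /= !expr0n /= !addr0 add0r expr1n sqrtr1 !sqrtr_sqr.
rewrite mul1r eIm -rmorphD ltcR /= [ltRHS]splitr ltrD //.
- by near: n.
- by near: n.
Unshelve. all: by end_near. Qed.

Lemma Re_sum u n :
  Re (\sum_(0 <= i < n) u i) = \sum_(0 <= i < n) Re (u i).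
Proof.
elim: n => [|n IH]; first by rewrite !big_geq.
by rewrite !big_nat_recr //= -IH; case: (\sum_(_ <= _ < _) _) => ? ?; case: (u n).
Qed.

Lemma Im_sum u n :
  Im (\sum_(0 <= i < n) u i) = \sum_(0 <= i < n) Im (u i).
Proof.
elim: n => [|n IH]; first by rewrite !big_geq.
by rewrite !big_nat_recr //= -IH; case: (\sum_(_ <= _ < _) _) => ? ?; case: (u n).
Qed.

Lemma normc_ge_Im a : `|Im a|%:C <= `|a|.
Proof.
by rewrite normc_def lecR -sqrtr_sqr ler_wsqrtr // lerDr sqr_ge0.
Qed.

Lemma cvg_complex_series u (v : nat -> R) :
  (forall n, `|u n| <= (v n)%:C) -> cvgn (series v) ->
  exists l : C, (\sum_(0 <= i < n) u i) @[n --> \oo] --> l.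
Proof.
move=> uv cv.
have v0 n : 0 <= v n by rewrite -lecR; apply: le_trans (uv n); exact: normr_ge0.
have cvRe : cvgn (series (fun n => Re (u n))).
  apply: normed_cvg; apply: series_le_cvg cv => // n /=; first exact: normr_ge0.
  by rewrite -lecR; apply: le_trans (uv n); exact: normc_ge_Re.
have cvIm : cvgn (series (fun n => Im (u n))).
  apply: normed_cvg; apply: series_le_cvg cv => // n /=; first exact: normr_ge0.
  by rewrite -lecR; apply: le_trans (uv n); exact: normc_ge_Im.
exists (limn (series (fun n => Re (u n))) +i* limn (series (fun n => Im (u n)))).
apply: cvg_complex => /=.
  by under eq_fun do rewrite Re_sum; exact: cvRe.
by under eq_fun do rewrite Im_sum; exact: cvIm.
Qed.

Lemma is_cexp_real (t : R) : is_cexp t%:C (expR t)%:C.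
Proof.
have E n : (exp_poly n).[t%:C] = (series (exp_coeff t) n)%:C.
  rewrite horner_exp_poly seriesEord /= rmorph_sum /=; apply: eq_bigr => i _.
  by rewrite mulrC rmorphM fmorphV rmorphXn rmorph_nat.
rewrite /is_cexp; under eq_fun do rewrite E.
apply: cvg_complex; last exact: cvg_cst.
exact: is_cvg_series_exp_coeff.
Qed.

(** By [exp_poly_add_le] the difference of the partial sums is dominated by the
same difference at |a| and |b|, which tends to 0 by the real case. *)
Lemma is_cexpD a b a' b' :
  is_cexp a a' -> is_cexp b b' -> is_cexp (a + b) (a' * b').
Proof.
move=> aa' bb'.
pose d n : C := (exp_poly n).[a] * (exp_poly n).[b] - (exp_poly n).[a + b].
have realE (c : C) : `|c| = (Re `|c|)%:C by rewrite RRe_real // ger0_real.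
have d0 : d n @[n --> \oo] --> (0 : C).
  pose D n : C := (exp_poly n).[`|a|] * (exp_poly n).[`|b|] -
    (exp_poly n).[`|a| + `|b|].
  have D0 : D n @[n --> \oo] --> (0 : C).
    rewrite (_ : 0 = (expR (Re `|a|))%:C * (expR (Re `|b|))%:C -
      (expR (Re `|a| + Re `|b|))%:C); last first.
      by rewrite expRD rmorphM subrr.
    rewrite /D (realE a) (realE b) -rmorphD; apply: cvgB; first apply: cvgM;
      exact: is_cexp_real.
  apply/cvgr0Pnorm_lt => e e0; move/cvgr0Pnorm_lt: D0 => /(_ e e0).
  apply: filterS => n; apply: le_lt_trans.
  rewrite [leRHS]ger0_norm; first exact: exp_poly_add_le.
  exact: le_trans (normr_ge0 _) (exp_poly_add_le n a b).
have dE : (fun n => (exp_poly n).[a + b]) =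
    (fun n => (exp_poly n).[a] * (exp_poly n).[b]) - d.
  by apply/funext => n; rewrite /d !fctE opprB addrC subrK.
rewrite /is_cexp dE -[X in _ --> X]subr0; apply: cvgB d0.
exact: (@cvgM _ _ _ _ (fun n => (exp_poly n).[a])
  (fun n => (exp_poly n).[b]) _ _ aa' bb').
Qed.

Lemma imag_expr (t : R) n :
  (0 +i* t) ^+ n = ((~~ odd n)%:R * (-1) ^+ n./2 * t ^+ n) +i*
                   ((odd n)%:R * (-1) ^+ n.-1./2 * t ^+ n).
Proof.
have E m : (0 +i* t) ^+ m.*2 = ((-1) ^+ m * t ^+ m.*2)%:C.
  rewrite -mul2n !exprM -exprMn rmorphXn; congr (_ ^+ _).
  rewrite expr2; apply/eqP; rewrite eq_complex /=.
  by apply/andP; split; apply/eqP; ring.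
have [m [->|->]] : exists m, n = m.*2 \/ n = m.*2.+1.
  exists n./2; have := odd_double_half n.
  by case: (odd n) => e; [right|left]; rewrite -[LHS]e.
  rewrite E /= odd_double doubleK /=.
  by apply/eqP; rewrite eq_complex /=; apply/andP; split; apply/eqP; ring.
rewrite exprS E /= odd_double doubleK uphalf_double exprS /=.
by apply/eqP; rewrite eq_complex /=; apply/andP; split; apply/eqP; ring.
Qed.

Lemma is_cexp_imag (t : R) : is_cexp (0 +i* t) (cos t +i* sin t).
Proof.
have E n : (exp_poly n).[0 +i* t] =
    series (cos_coeff t) n +i* series (sin_coeff t) n.
  rewrite horner_exp_poly /series /=.
  rewrite -(big_mkord predT (fun i => (i`!%:R)^-1 * (0 +i* t) ^+ i)).
  apply/eqP; rewrite eq_complex /= Re_sum Im_sum.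
  by apply/andP; split; apply/eqP; apply: eq_bigr => i _;
    rewrite imag_expr -(rmorph_nat (real_complex R)) -fmorphV;
    rewrite /cos_coeff /sin_coeff /= -?exprnP; ring.
rewrite /is_cexp; under eq_fun do rewrite E.
apply: cvg_complex => /=.
  rewrite unlock; exact: is_cvg_series_cos_coeff.
rewrite unlock; exact: is_cvg_series_sin_coeff.
Qed.

Lemma is_cexp_polar a :
  is_cexp a ((expR (Re a))%:C * (cos (Im a) +i* sin (Im a))).
Proof.
rewrite (_ : a = (Re a)%:C + (0 +i* Im a)) /=.
  apply: is_cexpD => /=; rewrite ?addr0 ?add0r; first exact: is_cexp_real.
  exact: is_cexp_imag.
by apply/eqP; rewrite eq_complex /= addr0 add0r !eqxx.
Qed.

Lemma is_cexp_neq0 a b : is_cexp a b -> b != 0.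
Proof.
move=> ab; have := is_cexpD ab (@is_cexp_polar (- a)); rewrite subrr => e0.
have := is_cexp_unique e0 (@is_cexp_real 0); rewrite expR0 => /eqP.
by apply: contraTneq => ->; rewrite mul0r eq_sym oner_eq0.
Qed.

(** Polar coordinates: b = r (cos v + i sin v) is the exponential of ln r + i v. *)
Lemma is_cexp_surj b : b != 0 -> exists a, is_cexp a b.
Proof.
move=> b0; pose r := Re `|b|.
have rE : `|b| = r%:C by rewrite RRe_real // ger0_real.
have r0 : 0 < r by rewrite -ltcR -rE normr_gt0.
have rn0 : r != 0 by rewrite gt_eqF.
have r2 : Re b ^+ 2 + Im b ^+ 2 = r ^+ 2.
  by apply: (@complexI R); rewrite add_Re2_Im2 rE rmorphXn.
pose c := Re b / r; pose s := Im b / r.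
have cs : c ^+ 2 + s ^+ 2 = 1 by rewrite !expr_div_n -mulrDl r2 divff // expf_neq0.
have c1 : -1 <= c <= 1.
  rewrite -ler_norml -(@ler_pXn2r _ 2) ?nnegrE // expr1n.
  by rewrite real_normK ?num_real // -cs lerDl sqr_ge0.
have [v [vc vs]] : exists v, cos v = c /\ sin v = s.
  have cosc : cos (acos c) = c by rewrite acosK // in_itv.
  have sinc : sin (acos c) = `|s|.
    by rewrite sin_acos // -cs addrAC subrr add0r sqrtr_sqr.
  case: (leP 0 s) => s0.
    by exists (acos c); rewrite cosc sinc ger0_norm.
  by exists (- acos c); rewrite cosN sinN cosc sinc ltr0_norm // opprK.
exists (ln r +i* v).
rewrite (_ : b = (expR (ln r))%:C * (cos v +i* sin v)); first exact: is_cexp_polar.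
rewrite lnK ?posrE // vc vs; apply/eqP; rewrite eq_complex /= !mul0r subr0 addr0.
by rewrite /c /s !mulrA ![r * _]mulrC !mulfK // !eqxx.
Qed.

End ComplexExp.

(** * Taylor expansion of polynomials *)

Lemma comp_0poly (K : comNzRingType) (r : {poly K}) : 0 \Po r = 0.
Proof. exact: (comp_polyC 0). Qed.

Section Taylor.
Context {K : comNzRingType}.
Implicit Types (p r h : {poly K}).

Lemma comp_poly_taylor1 p r h :
  exists g, (p \Po (r + h)) - (p \Po r) = h * g.
Proof.
elim/poly_ind: p => [|p c [g gE]].
  by exists 0; rewrite !comp_0poly subrr mulr0.
exists (g * (r + h) + (p \Po r)).
rewrite !comp_polyD !comp_polyM !comp_polyX !comp_polyC.
by rewrite (canRL (subrK _) gE); ring.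
Qed.

Lemma comp_poly_taylor2 p r h :
  exists g, (p \Po (r + h)) - (p \Po r) - h * (p^`() \Po r) = h ^+ 2 * g.
Proof.
elim/poly_ind: p => [|p c [g gE]].
  by exists 0; rewrite deriv0 !comp_0poly !mulr0 !subrr.
exists (g * (r + h) + (p^`() \Po r)).
rewrite derivD derivM derivX derivC mulr1 addr0.
rewrite !comp_polyD !comp_polyM !comp_polyX !comp_polyC.
rewrite (canRL (subrK _) (canRL (subrK _) gE)); ring.
Qed.

End Taylor.

Lemma deriv_exp_poly (K : numFieldType) n :
  (exp_poly n.+1)^`() = exp_poly n :> {poly K}.
Proof.
apply/polyP => i; rewrite coef_deriv !coef_poly ltnS; case: ltnP => _; last first.
  by rewrite mul0rn.
by rewrite factS natrM invfM -[LHS]mulr_natr mulrAC mulVf ?mul1r // pnatr_eq0.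
Qed.

(** * Coordinatewise limits *)

Lemma cvg_sum_seq (K : numFieldType) (I : Type) (s : seq I)
    (f : nat -> I -> K) (g : I -> K) :
  (forall i, f n i @[n --> \oo] --> g i) ->
  \sum_(i <- s) f n i @[n --> \oo] --> \sum_(i <- s) g i.
Proof.
move=> fg; elim: s => [|i s IH].
  rewrite big_nil (_ : (fun n => _) = cst 0); first exact: cvg_cst.
  by apply/funext => n; rewrite big_nil.
rewrite big_cons (_ : (fun n => _) = (f^~ i) + (fun n => \sum_(j <- s) f n j)).
  exact: cvgD.
by apply/funext => n; rewrite big_cons.
Qed.

Section CoordConvergence.
Context {K : numFieldType} {A : altAlgType K}.
Implicit Types (u v : nat -> A) (l : A).

Definition cvg_coord u l := forall i,
  (coord (vbasis {:A}) i (u n) : K) @[n --> \oo] -->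
  (coord (vbasis {:A}) i l : K).

Lemma cvg_coord_eq u l m : cvg_coord u l -> cvg_coord u m -> l = m.
Proof.
move=> ul um; rewrite (coord_vbasis (memvf l)) (coord_vbasis (memvf m)).
apply: eq_bigr => i _; congr (_ *: _).
by apply: cvg_unique (ul i) (um i); exact: norm_hausdorff.
Qed.

Lemma cvg_coord_cst l : cvg_coord (fun=> l) l.
Proof. by move=> i; exact: cvg_cst. Qed.

Lemma cvg_coordB u v l m :
  cvg_coord u l -> cvg_coord v m -> cvg_coord (fun n => u n - v n) (l - m).
Proof.
move=> ul vm i; rewrite linearB /=; under eq_fun do rewrite linearB.
exact: cvgB (ul i) (vm i).
Qed.

Lemma cvg_coordZ (c : nat -> K) (b : K) l :
  c n @[n --> \oo] --> b -> cvg_coord (fun n => c n *: l) (b *: l).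
Proof.
move=> cb i; rewrite linearZ /=; under eq_fun do rewrite linearZ /=.
exact: cvgMr_tmp.
Qed.

Lemma cvg_coord_shift u l : cvg_coord u l -> cvg_coord (fun n => u n.+1) l.
Proof. by move=> ul i; move: (ul i); rewrite -cvg_shiftS. Qed.

Lemma cvg_coord_lfun (f : 'End(A)) u l :
  cvg_coord u l -> cvg_coord (fun n => f (u n)) (f l).
Proof.
move=> ul i.
have fE w : coord (vbasis {:A}) i (f w) =
    \sum_j coord (vbasis {:A}) j w * coord (vbasis {:A}) i (f (vbasis {:A})`_j).
  rewrite {1}(coord_vbasis (memvf w)) !linear_sum.
  by apply: eq_bigr => j _; rewrite !linearZ.
rewrite fE; under eq_fun do rewrite fE.
by apply: cvg_sum_seq => j; apply: cvgMr_tmp; exact: ul.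
Qed.

Lemma cvg_coord_mem (U : {vspace A}) u l :
  (forall n, u n \in U) -> cvg_coord u l -> l \in U.
Proof.
move=> uU ul.
have := cvg_coord_lfun (f := projv U) ul.
under eq_fun do rewrite projv_id //.
by move=> /(cvg_coord_eq ul) ->; exact: memv_proj.
Qed.

(** Convergence of the coordinates is convergence in the matrix topology used by
the definition of [altexp]. *)
Lemma altexpE z l : cvg_coord (exp_psum z) l -> altexp z = l.
Proof.
move=> zl; rewrite /altexp -[RHS](passmx.rVofK (vbasisP {:A})); congr passmx.vecof.
apply: cvg_lim; first exact: norm_hausdorff.
move=> B [P nP PB].
have : \forall n \near \oo, forall ij : 'I_1 * 'I_(\dim {:A}),
    P ij.1 ij.2 (passmx.rVof (vbasis {:A}) (exp_psum z n) ij.1 ij.2).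
  apply: filter_forall => -[i j] /=.
  have Pl : nbhs (coord (vbasis {:A}) j l) (P i j) by move: (nP i j); rewrite mxE.
  have Pn : \forall n \near \oo, P i j (coord (vbasis {:A}) j (exp_psum z n)).
    exact: zl j _ Pl.
  by near do rewrite mxE.
apply: filterS => n Pn; apply: PB => i j; exact: (Pn (i, j)).
Unshelve. all: by end_near. Qed.

Lemma exp_psum_aeval (x : A) r n :
  exp_psum (K := K) (aeval x r) n = aeval x (exp_poly n \Po r).
Proof.
rewrite /exp_psum big_mkord /exp_poly poly_def linear_sum /= linear_sum.
apply: eq_bigr => i _.
by rewrite linearZ /= linearZ /= comp_Xn_poly apow_aeval.
Qed.

(** Ideals of k[X] containing the annihilator p are closed: if p = w q, then
membership of g in (q) is the linear condition w(x) g(x) = 0, which is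
preserved by limits. *)
Lemma cvg_coord_dvdp (x : A) p q (f : nat -> {poly K}) s :
  (forall g, aeval x g = 0 <-> p %| g) -> p != 0 -> q %| p ->
  (forall n, q %| f n) -> cvg_coord (fun n => aeval x (f n)) (aeval x s) ->
  q %| s.
Proof.
move=> pP p0 /dvdpP[w pE] qf fs.
have w0 : w != 0 by apply: contraNneq p0 => w0; rewrite pE w0 mul0r.
rewrite -(dvdp_mul2l _ _ w0) -pE; apply/pP.
rewrite aevalM -lmultE; have := cvg_coord_lfun (f := lmult (aeval x w)) fs.
have -> : (fun n => lmult (aeval x w) (aeval x (f n))) = (fun=> 0).
  apply/funext => n; rewrite lmultE -aevalM; apply/pP.
  by rewrite pE dvdp_mul2l.
by move/(cvg_coord_eq (@cvg_coord_cst 0)).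
Qed.

End CoordConvergence.

(** * Convergence of the exponential series *)

Section Exponential.
Local Open Scope complex_scope.
Local Notation Re := (@complex.Re _).
Context {R : realType}.
Local Notation C := (R[i] : numFieldType).
Context {A : altAlgType C}.
Implicit Types (x z l : A) (p q r s : {poly C}).

(* The l1 norm of the coordinates, for which multiplication by z is bounded. *)
Let cnorm (v : A) : C := \sum_i `|coord (vbasis {:A}) i v|.

Lemma apow_coord_bound z : exists2 M : R, 0 <= M & exists2 N : R, 0 <= N &
  forall i n, `|coord (vbasis {:A}) i (apow z n)| <= (N * M ^+ n)%:C.
Proof.
have realC (c : C) : 0 <= c -> c = (Re c)%:C /\ 0 <= Re c.
  by move=> c0; rewrite -lecR RRe_real ?ger0_real.
have cnorm_ge0 v : 0 <= cnorm v by apply: sumr_ge0.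
pose M := \sum_(j < \dim {:A}) cnorm (z ** (vbasis {:A})`_j).
have M0 : 0 <= M by apply: sumr_ge0.
have cnormM v : cnorm (z ** v) <= M * cnorm v.
  rewrite mulr_suml [X in X <= _](_ : _ = \sum_i
    `|\sum_(j < \dim {:A}) coord (vbasis {:A}) j v *
      coord (vbasis {:A}) i (z ** (vbasis {:A})`_j)|); last first.
    apply: eq_bigr => i _; congr `|_|.
    rewrite {1}(coord_vbasis (memvf v)) -lmultE !linear_sum.
    by apply: eq_bigr => j _; rewrite !linearZ /= lmultE.
  apply: (@le_trans _ _ (\sum_i \sum_(j < \dim {:A})
      `|coord (vbasis {:A}) j v| *
      `|coord (vbasis {:A}) i (z ** (vbasis {:A})`_j)|)).
    apply: ler_sum => i _; apply: le_trans (ler_norm_sum _ _ _) _.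
    by apply: ler_sum => j _; rewrite normrM.
  rewrite exchange_big /=; apply: ler_sum => j _.
  rewrite -mulr_sumr mulrC; apply: ler_wpM2l; first exact: cnorm_ge0.
  by rewrite /cnorm (bigD1 j) //= lerDl sumr_ge0.
have [ME Mr] := realC _ M0; have [NE Nr] := realC _ (cnorm_ge0 \one).
exists (Re M) => //; exists (Re (cnorm \one)) => // i n.
rewrite rmorphM rmorphXn /= -[X in X * _]NE -[X in _ * X ^+ _]ME.
apply: (@le_trans _ _ (cnorm (apow z n))).
  by rewrite /cnorm (bigD1 i) //= lerDl sumr_ge0.
elim: n => [|n IH]; first by rewrite expr0 mulr1.
by apply: le_trans (cnormM _) _; rewrite exprS mulrCA ler_wpM2l.
Qed.

(** Each coordinate of the series is dominated by the series of N exp(M). *)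
Lemma exp_psum_cvg z : exists l, cvg_coord (exp_psum (K := C) z) l.
Proof.
have [M M0 [N N0 zMN]] := apow_coord_bound z.
have /choice[l lP] : forall i, exists c : C,
    coord (vbasis {:A}) i (exp_psum (K := C) z n) @[n --> \oo] --> c.
  move=> i.
  have [c cP] : exists c : C, \sum_(0 <= j < n)
      (coord (vbasis {:A}) i ((j`!%:R)^-1 *: apow z j) : C) @[n --> \oo] --> c.
    apply: (@cvg_complex_series _ _ (N *: exp_coeff M)) => [j|]; last first.
      by apply: is_cvg_seriesZ; exact: is_cvg_series_exp_coeff.
    rewrite linearZ /= normrM normfV normr_nat mulrC.
    rewrite /exp_coeff /= !fctE /= -[N *: _]/(N * _).
    rewrite mulrA rmorphM fmorphV rmorph_nat.
    by rewrite ler_wpM2r ?invr_ge0 ?ler0n.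
  exists c; rewrite (_ : (fun n => _) = (fun n => \sum_(0 <= j < n)
      (coord (vbasis {:A}) i ((j`!%:R)^-1 *: apow z j)))) //.
  by apply/funext => n; rewrite /exp_psum linear_sum.
exists (\sum_i l i *: (vbasis {:A})`_i) => i.
by rewrite coord_sum_free ?(basis_free (vbasisP _)).
Qed.

End Exponential.

(** * Exponentials and logarithms modulo the annihilator *)

(* The analysis enters only through the convergence of exp on A and through the
existence, surjectivity and nonvanishing of the scalar exponential. *)
Section Logarithm.
Context {K : numFieldType} {A : altAlgType K}.
Implicit Types (p q r s : {poly K}) (a b c : K).
Context (exp_cvg : forall z : A, exists l, cvg_coord (exp_psum (K := K) z) l).

(** The relation exp(r) = s modulo the annihilator of x. *)
Definition is_pexp (x : A) r s :=
  cvg_coord (fun n => aeval x (exp_poly n \Po r)) (aeval x s).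

Lemma is_pexp_altexp x r s :
  is_pexp x r s -> altexp (K := K) (aeval x r) = aeval x s.
Proof.
move=> rs; apply: altexpE.
by rewrite (_ : exp_psum _ = fun n => aeval x (exp_poly n \Po r)) //;
  apply/funext => n; exact: exp_psum_aeval.
Qed.

(** The limit of polynomials in x is a polynomial in x: they span a subspace,
generated by the powers of x below the degree of its annihilator. *)
Lemma is_pexp_ex x r : exists s, is_pexp x r s.
Proof.
have [p pm pP] := annihilatorP x.
have [l lP] := exp_cvg (aeval x r).
pose d := size p; pose U := <<powers x d>>%VS.
have mem_aeval g : aeval x g \in U.
  have gp : aeval x g = aeval x (g %% p).
    rewrite {1}(divp_eq g p) linearD /= [X in X + _](_ : _ = 0) ?add0r //.
    by apply/pP; exact: dvdp_mull.
  rewrite gp (@aeval_widen _ _ d) ?(ltnW (ltn_modp _ _)) //; last first.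
    by rewrite ltnW // ltn_modp monic_neq0.
  apply: memv_suml => i _; apply/memvZ/memv_span.
  by apply/mapP; exists i; rewrite // mem_enum.
have : l \in U.
  by apply: cvg_coord_mem lP => n; rewrite exp_psum_aeval; exact: mem_aeval.
move=> lU; exists (rVpoly (\row_i coord (powers x d) i l)).
rewrite /is_pexp aeval_rVpoly.
have <- : l = \sum_(i < d) (\row_i coord (powers x d) i l) 0 i *: (powers x d)`_i.
  by rewrite {1}(coord_span lU); apply: eq_bigr => i _; rewrite mxE.
rewrite (_ : (fun n => _) = exp_psum (K := K) (aeval x r)) //.
by apply/funext => n; rewrite exp_psum_aeval.
Qed.

Context (cexp_ex : forall a, exists b, is_cexp a b).
Context (cexp_surj : forall b, b != 0 -> exists a, is_cexp a b).
Context (x : A) (p : {poly K}).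
Context (p_monic : p \is monic).
Context (pP : forall q, aeval x q = 0 <-> p %| q).

Let p_neq0 : p != 0. Proof. exact: monic_neq0. Qed.

(** E_n(r) - E_n(r(a)) is divisible by X - a, hence so is s - exp(r(a)). *)
Lemma is_pexp_root r s a : is_pexp x r s -> root p a -> is_cexp r.[a] s.[a].
Proof.
move=> rs pa; have [b rb] := cexp_ex r.[a].
suff -> : s.[a] = b by [].
have : ('X - a%:P) %| s - b%:P.
  apply: (@cvg_coord_dvdp _ _ x p _
    (fun n => (exp_poly n \Po r) - ((exp_poly n).[r.[a]])%:P)) => //.
  - by rewrite dvdp_XsubCl.
  - by move=> n; rewrite dvdp_XsubCl rootE !hornerE horner_comp subrr.
  - rewrite linearB /= aevalC.
    under eq_fun do rewrite linearB /= aevalC.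
    by apply: cvg_coordB => //; exact: cvg_coordZ.
by rewrite dvdp_XsubCl rootE !hornerE subr_eq0 => /eqP.
Qed.

Lemma is_pexp_congr r r' s s' q : q %| p -> q %| r' - r ->
  is_pexp x r s -> is_pexp x r' s' -> q %| s' - s.
Proof.
move=> qp qr rs rs'.
apply: (@cvg_coord_dvdp _ _ x p _
  (fun n => (exp_poly n \Po r') - (exp_poly n \Po r))) => //.
  move=> n; have [g] := comp_poly_taylor1 (exp_poly n) r (r' - r).
  by rewrite subrKC => ->; exact: dvdp_mulr.
rewrite linearB /=; under eq_fun do rewrite linearB /=.
exact: cvg_coordB.
Qed.

(** First order Taylor expansion exp(r + h) = exp(r) (1 + h) modulo h^2, the
derivative of E_(n+1) being E_n. *)
Lemma is_pexp_taylor r h s s' q : q %| p -> q %| h ^+ 2 ->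
  is_pexp x r s -> is_pexp x (r + h) s' -> q %| s' - s - h * s.
Proof.
move=> qp qh rs rs'.
apply: (@cvg_coord_dvdp _ _ x p _ (fun n => (exp_poly n.+1 \Po (r + h)) -
  (exp_poly n.+1 \Po r) - h * (exp_poly n \Po r))) => //.
  move=> n; have [g] := comp_poly_taylor2 (exp_poly n.+1) r h.
  by rewrite deriv_exp_poly => ->; exact: dvdp_mulr.
rewrite !linearB /= aevalM -lmultE.
under eq_fun do rewrite !linearB /= aevalM -lmultE.
apply: cvg_coordB; last exact: cvg_coord_lfun.
by apply: cvg_coordB; [exact: (cvg_coord_shift rs')|exact: (cvg_coord_shift rs)].
Qed.

(** A logarithm of X modulo a product of linear factors of the annihilator, by
Newton-like correction of a logarithm modulo one factor less. *)
Lemma polynomial_log (rs : seq K) : ~~ root p 0 ->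
  \prod_(a <- rs) ('X - a%:P) %| p ->
  exists r s, is_pexp x r s /\ \prod_(a <- rs) ('X - a%:P) %| s - 'X.
Proof.
move=> p0; elim: rs => [|a rs IH].
  rewrite big_nil => _; have [s exp_0s] := is_pexp_ex x 0.
  by exists 0, s; rewrite dvd1p.
rewrite big_cons; set q := \prod_(b <- rs) _ in IH * => qXp.
have qp : q %| p by exact: dvdp_trans (dvdp_mull _ _) qXp.
have ap : root p a.
  by rewrite -dvdp_XsubCl; exact: dvdp_trans (dvdp_mulr _ _) qXp.
have a0 : a != 0 by apply: contraNneq p0 => <-.
have [r [s [exp_rs /dvdpP[t tE]]]] := IH qp.
have [qa|qa] := boolP (root q a); last first.
  (* Here X - a and q are coprime, so the value at a can be prescribed. *)
  have [b ba] := cexp_surj a0.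
  have [s' rs'] := is_pexp_ex x (r + ((b - r.[a]) / q.[a]) *: q).
  exists (r + ((b - r.[a]) / q.[a]) *: q), s'; split=> //.
  rewrite Gauss_dvdp; last by rewrite coprimep_sym coprimep_XsubC.
  apply/andP; split.
    rewrite dvdp_XsubCl rootE !hornerE subr_eq0; apply/eqP.
    have := is_pexp_root rs' ap.
    rewrite !hornerE divfK // subrKC => ba'.
    exact: is_cexp_unique ba' ba.
  rewrite -(subrK s s') -addrA dvdp_add //; last by rewrite tE dvdp_mull.
  by apply: is_pexp_congr exp_rs rs' => //;
    rewrite addrAC subrr add0r -mul_polyC dvdp_mull.
(* Here q^2 = 0 modulo (X - a) q. With s = X + t q, the new exponential is
   s + c q s = X + (t + c s) q, so t + c s must vanish at a, where s(a) = a. *)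
pose c := - t.[a] / a.
have [s' rs'] := is_pexp_ex x (r + c *: q).
exists (r + c *: q), s'; split=> //.
have -> : s' - 'X = (s' - s - (c *: q) * s) + (t + c *: s) * q.
  by rewrite mulrDl -tE -!scalerAl [s * q]mulrC; ring.
rewrite dvdp_add //.
  apply: is_pexp_taylor exp_rs rs' => //.
  rewrite exprZn -mul_polyC dvdp_mull // expr2 dvdp_mul //.
  by rewrite dvdp_XsubCl.
rewrite dvdp_mul // dvdp_XsubCl rootE !hornerE.
have -> : s.[a] = a.
  have := congr1 (horner^~ a) tE; rewrite !hornerE (rootP qa) mulr0.
  by move/eqP; rewrite subr_eq0 => /eqP.
by rewrite divfK // subrr.
Qed.

Context (rs : seq K) (p_split : p = \prod_(a <- rs) ('X - a%:P)).

Lemma altexp_surj : ~~ root p 0 -> exists r, altexp (K := K) (aeval x r) = x.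
Proof.
move=> p0; have [|r [s [exp_rs]]] := @polynomial_log rs p0.
  by rewrite -p_split.
rewrite -p_split => /pP; rewrite linearB /= aevalX => /eqP; rewrite subr_eq0.
by move=> /eqP sx; exists r; rewrite (is_pexp_altexp exp_rs).
Qed.

(** If exp(x) = s(x), then s is nonzero at the roots of the annihilator of x, so
a Bézout relation inverts s(x). *)
Lemma altexp_unit : (forall a b, is_cexp a b -> b != 0) ->
  exists y, y ** altexp (K := K) x = \one.
Proof.
move=> cexp_neq0; have [s xs] := is_pexp_ex x 'X.
rewrite -[in altexp _](aevalX x) (is_pexp_altexp xs).
have : coprimep s p.
  have : {in rs, forall a, s.[a] != 0}.
    move=> a ars; apply: (cexp_neq0 'X.[a]); apply: is_pexp_root xs _.
    by rewrite p_split root_prod_XsubC.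
  rewrite p_split; elim: rs => [|a l IH] s0; first by rewrite big_nil coprimep1.
  rewrite big_cons coprimepMr coprimep_XsubC /root s0 ?mem_head //=.
  by apply: IH => b bl; apply: s0; rewrite inE bl orbT.
case/Bezout_eq1_coprimepP=> -[u v] /= uv1; exists (aeval x u).
rewrite -aevalM -(aeval1 x) -uv1 linearD /=.
by rewrite [X in _ + X](_ : _ = 0) ?addr0 //; apply/pP; exact: dvdp_mull.
Qed.

End Logarithm.

Section ComplexAlgebra.
Context {R : realType} {A : altAlgType R[i]}.
Implicit Types (x y z : A).

Let is_cexp_ex (a : (R[i] : numFieldType)) : exists b, is_cexp a b.
Proof. by eexists; exact: is_cexp_polar. Qed.

Lemma annihilator_split x : exists p rs, [/\ p \is monic,
  forall q, aeval x q = 0 <-> p %| q & p = \prod_(a <- rs) ('X - a%:P)].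
Proof.
have [p pm pP] := annihilatorP x; exists p.
have [rs pE] := closed_field_poly_normal p; exists rs; split=> //.
by rewrite {1}pE (monicP pm) scale1r.
Qed.

Lemma altexp_left_invertible z : exists y, y ** altexp z = \one.
Proof.
have [p [rs [pm pP pE]]] := annihilator_split z.
exact: (altexp_unit (@exp_psum_cvg R A) is_cexp_ex pm pP pE (@is_cexp_neq0 R)).
Qed.

Lemma left_invertible_altexp x : (exists y, y ** x = \one) ->
  exists2 z, subalg_gen x z & altexp z = x.
Proof.
move=> xinv; have [p [rs [pm pP pE]]] := annihilator_split x.
have p0 : ~~ root p 0.
  apply/negP => /(annihilator_root0 pm pP)[q [xq0 _ xq]].
  have [/(_ xinv _ xq0) + _] := (invertible_tfae x) 0%N 4%N.
  by rewrite xq eqxx.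
have [r rx] := altexp_surj (@exp_psum_cvg R A) is_cexp_ex
  (@is_cexp_surj R) pm pP pE p0.
by exists (aeval x r) => //; exact: aeval_subalg_gen.
Qed.

End ComplexAlgebra.

Theorem proposition5p3 :
  (forall (k : fieldType) (A : altAlgType k) (x : A),
     let A0 := subalg_gen x in
     [<-> (exists y : A, y ** x = \one);
          (exists y : A, x ** y = \one);
          (exists2 y : A, A0 y & y ** x = \one);
          (exists2 y : A, A0 y & x ** y = \one);
          (forall y : A, y != 0 -> x ** y != 0);
          (forall y : A, y != 0 -> y ** x != 0);
          (forall y : A, A0 y -> y != 0 -> x ** y != 0);
          (forall y : A, A0 y -> y != 0 -> y ** x != 0);
          end_det (lmult x) != 0;
          end_det (rmult x) != 0]) /\
  (forall (R : realType) (A : altAlgType R[i]) (x : A),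
     let A0 := subalg_gen x in
     [<-> (exists y : A, y ** x = \one);
          (exists y : A, x ** y = \one);
          (exists2 y : A, A0 y & y ** x = \one);
          (exists2 y : A, A0 y & x ** y = \one);
          (forall y : A, y != 0 -> x ** y != 0);
          (forall y : A, y != 0 -> y ** x != 0);
          (forall y : A, A0 y -> y != 0 -> x ** y != 0);
          (forall y : A, A0 y -> y != 0 -> y ** x != 0);
          end_det (lmult x) != 0;
          end_det (rmult x) != 0;
          (exists z : A, altexp z = x);
          (exists2 z : A, A0 z & altexp z = x)]).
Proof.
split=> [k A x|R A x A0]; first exact: invertible_tfae.
have T := invertible_tfae x.
tfae.
- exact: (T 0 1).1.
- exact: (T 1 2).1.
- exact: (T 2 3).1.
- exact: (T 3 4).1.
- exact: (T 4 5).1.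
- exact: (T 5 6).1.
- exact: (T 6 7).1.
- exact: (T 7 8).1.
- exact: (T 8 9).1.
- by move=> /(T 9 0)/left_invertible_altexp[z _ zx]; exists z.
- move=> [z zx]; apply: left_invertible_altexp; rewrite -zx.
  exact: altexp_left_invertible.
- by move=> [z _ <-]; exact: altexp_left_invertible.
Qed.
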